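(* Let $\widetilde A\in\mathbb{R}^{m\times n}$, $\widetilde A\neq 0$, $\widetilde b\in\mathbb{R}^m$ and $x_0\in\mathbb{R}^n$. Among all the balls $$B\left(x_0^n+x_*^r,\ \frac{\|\widetilde A x_*-\widetilde b\|}{\widetilde\sigma_{\min}}\right),\qquad x_*\in\mathbb{R}^n,$$ the smallest radius is attained when $x_*=\widetilde x_{\rm LS}+y$, where $\widetilde x_{\rm LS}=\widetilde A^\dagger\widetilde b$ is the (minimum-norm) least squares solution to $\widetilde A x\approx\widetilde b$ and $y\in\mathrm{null}(\widetilde A)$. Moreover, the center of the smallest ball is given by $x_0^n+\widetilde x_{\rm LS}$.
   Context: $B(c,\rho)$ denotes the ball in $\mathbb{R}^n$ with center $c$ and radius $\rho$; $\|\cdot\|$ is the Euclidean norm; $\widetilde\sigma_{\min}$ is the smallest nonzero singular value of $\widetilde A$; $\widetilde A^\dagger$ is the Moore–Penrose pseudoinverse. For $v\in\mathbb{R}^n$, $v^r$ denotes the orthogonal projection of $v$ onto $\mathrm{range}(\widetilde A^\top)$ and $v^n$ the orthogonal projection of $v$ onto $\mathrm{null}(\widetilde A)$. *)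

(* Defs.v *)
From HB Require Import structures.
From mathcomp Require Import all_boot all_order all_algebra.
From mathcomp Require Import boolp classical_sets reals.

Set Implicit Arguments.
Unset Strict Implicit.
Unset Printing Implicit Defensive.

Import Order.TTheory GRing.Theory Num.Theory.
Local Open Scope classical_set_scope.
Local Open Scope ring_scope.

Section Euclidean.
Context {R : realType}.

Definition dotp n (u v : 'cV[R]_n) : R := \sum_(i < n) u i 0 * v i 0.

(* The norm that MathComp-Analysis puts on matrices is the sup norm. *)
Definition enorm n (u : 'cV[R]_n) : R := Num.sqrt (dotp u u).

Definition range_mx m n (A : 'M[R]_(m, n)) : set 'cV[R]_m :=
  [set A *m x | x in [set: 'cV[R]_n]].

Definition null_mx m n (A : 'M[R]_(m, n)) : set 'cV[R]_n :=
  [set x | A *m x = 0].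

Definition orth_proj n (S : set 'cV[R]_n) (v : 'cV[R]_n) : 'cV[R]_n :=
  xget 0 [set p | S p /\ forall s, S s -> dotp (v - p) s = 0].

(* The four Penrose equations. *)
Definition moore_penrose m n (A : 'M[R]_(m, n)) (P : 'M[R]_(n, m)) : Prop :=
  [/\ A *m P *m A = A, P *m A *m P = P,
      (A *m P)^T = A *m P & (P *m A)^T = P *m A].

Definition pinvmp m n (A : 'M[R]_(m, n)) : 'M[R]_(n, m) :=
  xget 0 [set P | moore_penrose A P].

(* [eigenvalue] refers to row eigenvectors, which is immaterial here because
   A^T *m A is symmetric. *)
Definition singular_value m n (A : 'M[R]_(m, n)) (s : R) : Prop :=
  0 <= s /\ eigenvalue (A^T *m A) (s ^+ 2).

Definition sigma_min m n (A : 'M[R]_(m, n)) : R :=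
  xget 0 [set s | [/\ singular_value A s, s != 0 &
    forall t, singular_value A t -> t != 0 -> s <= t]].

Definition least_squares_sol m n (A : 'M[R]_(m, n)) (b : 'cV[R]_m)
    (x : 'cV[R]_n) : Prop :=
  forall z : 'cV[R]_n, enorm (A *m x - b) <= enorm (A *m z - b).

Definition min_norm_least_squares_sol m n (A : 'M[R]_(m, n)) (b : 'cV[R]_m)
    (x : 'cV[R]_n) : Prop :=
  least_squares_sol A b x /\
  forall z : 'cV[R]_n, least_squares_sol A b z -> z != x -> enorm x < enorm z.

End Euclidean.

(* B(c, rho) is given by the pair (c, rho), so that its center and its radius
   make sense for rho = 0 whether balls are open or closed. *)
Record eball (R : realType) (n : nat) :=
  EBall { center : 'cV[R]_n; radius : R }.

Definition smallest_ball (R : realType) n (F : set (eball R n))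
    (B : eball R n) : Prop :=
  F B /\ forall B', F B' -> radius B <= radius B'.

Definition error_ball (R : realType) m n (A : 'M[R]_(m, n)) (b : 'cV[R]_m)
    (x0 xs : 'cV[R]_n) : eball R n :=
  EBall (orth_proj (null_mx A) x0 + orth_proj (range_mx A^T) xs)
        (enorm (A *m xs - b) / sigma_min A).

Definition error_balls (R : realType) m n (A : 'M[R]_(m, n)) (b : 'cV[R]_m)
    (x0 : 'cV[R]_n) : set (eball R n) :=
  [set error_ball A b x0 xs | xs in [set: 'cV[R]_n]].

(* Main.v *)
Require Import Defs.
From mathcomp Require Import all_boot all_order all_algebra.
From mathcomp Require Import boolp classical_sets reals.
From mathcomp Require Import spectral sesquilinear complex.
Import Order.TTheory GRing.Theory Num.Theory.
Local Open Scope ring_scope.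

(** Write x = A^+ b, where A^+ is the pseudoinverse.  The residual A x - b is
orthogonal to the range of A ([pinvmp_normal_eq]), so Pythagoras gives
    |A z - b|^2 = |A (z - x)|^2 + |A x - b|^2       ([residual_pythagoras])
for every z.  Hence x minimises the residual norm, and the minimisers are
exactly the points z with A (z - x) = 0, i.e. x + null(A).  Since x lies in
range(A^T), the orthogonal complement of null(A), a second use of Pythagoras
makes x the minimiser of least norm, and x is the projection onto range(A^T) of
every minimiser.

The radius of a ball is the residual norm divided by the smallest nonzero
singular value s.  When s > 0, the smallest balls come exactly from the
minimisers of the residual, so all of them have the same center, x0^n + x.

Both objects in this argument are chosen by description, so they have to be
shown to exist.
- The pseudoinverse comes from a full-rank factorisation A = C B, with the
  formula A^+ = B^T (B B^T)^-1 (C^T C)^-1 C^T ([moore_penrose_exists]).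
- For s, A^T A is real symmetric: the spectral theorem over the complex numbers
  shows that its eigenvalues form a finite family of reals, not all zero unless
  A^T A = 0 ([symmetric_spectrum]).  If A is nonzero then so is A^T A, hence a
  smallest nonzero eigenvalue exists; it is positive and its square root is s
  ([sigma_min_gt0]).  Without this, s would be the default value 0, every radius
  would be 0, and the center of a smallest ball would not be determined. *)

Set Implicit Arguments.
Unset Strict Implicit.
Unset Printing Implicit Defensive.

(** * The dot product and orthogonal projections *)

Section DotProduct.
Context {R : realType}.

Lemma dotpC n (u v : 'cV[R]_n) : dotp u v = dotp v u.
Proof. by apply: eq_bigr => i _; rewrite mulrC. Qed.

Lemma dotpE n (u v : 'cV[R]_n) : dotp u v = (u^T *m v) 0 0.
Proof. by rewrite mxE; apply: eq_bigr => i _; rewrite mxE. Qed.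

Lemma dotpDl n (u v w : 'cV[R]_n) : dotp (u + v) w = dotp u w + dotp v w.
Proof. by rewrite !dotpE linearD mulmxDl mxE. Qed.

Lemma dotpBl n (u v w : 'cV[R]_n) : dotp (u - v) w = dotp u w - dotp v w.
Proof. by rewrite !dotpE linearB mulmxBl !mxE. Qed.

Lemma dotpBr n (u v w : 'cV[R]_n) : dotp u (v - w) = dotp u v - dotp u w.
Proof. by rewrite dotpC dotpBl dotpC [dotp w u]dotpC. Qed.

Lemma dotp_mulmx m n (A : 'M[R]_(m, n)) (u : 'cV[R]_n) (v : 'cV[R]_m) :
  dotp (A *m u) v = dotp u (A^T *m v).
Proof. by rewrite !dotpE trmx_mul mulmxA. Qed.

Lemma dotp_ge0 n (u : 'cV[R]_n) : 0 <= dotp u u.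
Proof. by apply: sumr_ge0 => i _; rewrite -expr2 sqr_ge0. Qed.

Lemma dotp_eq0 n (u : 'cV[R]_n) : (dotp u u == 0) = (u == 0).
Proof.
apply/eqP/eqP => [u0|->]; last first.
  by apply: big1 => i _; rewrite mxE mul0r.
apply/matrixP => i j; rewrite ord1 mxE.
have sq_ge0 (k : 'I_n) : true -> 0 <= u k 0 * u k 0.
  by rewrite -expr2 sqr_ge0.
have /eqP := psumr_eq0P sq_ge0 u0 (isT : (fun=> true) i).
by rewrite mulf_eq0 orbb => /eqP.
Qed.

Lemma enorm_le n p (u : 'cV[R]_n) (v : 'cV[R]_p) :
  (enorm u <= enorm v) = (dotp u u <= dotp v v).
Proof. by rewrite /enorm ler_sqrt // dotp_ge0. Qed.

Lemma enorm_lt n p (u : 'cV[R]_n) (v : 'cV[R]_p) :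
  (enorm u < enorm v) = (dotp u u < dotp v v).
Proof. by rewrite !ltNge enorm_le. Qed.

Lemma pythagoras n (u v : 'cV[R]_n) :
  dotp u v = 0 -> dotp (u + v) (u + v) = dotp u u + dotp v v.
Proof.
by move=> uv; rewrite dotpDl ![dotp _ (u + v)]dotpC !dotpDl [dotp v u]dotpC uv
  addr0 add0r.
Qed.

(** Each column c of X satisfies |A c|^2 = <c, A^T A c> = 0. *)
Lemma gram_eq0 m n p (A : 'M[R]_(m, n)) (X : 'M[R]_(n, p)) :
  A^T *m A *m X = 0 -> A *m X = 0.
Proof.
move=> AX0; apply/matrixP => i j.
have: A *m col j X = 0.
  apply/eqP; rewrite -dotp_eq0 dotp_mulmx mulmxA colE mulmxA AX0 mul0mx.
  by rewrite dotpE mulmx0 mxE.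
by rewrite colE mulmxA -colE => /matrixP/(_ i 0); rewrite !mxE.
Qed.

(** Two candidates p, q satisfy q - p = (v - p) - (v - q), which is orthogonal to
S and so to p and q themselves; thus |q - p|^2 = 0. *)
Lemma orth_proj_unique n (S : set 'cV[R]_n) (v p : 'cV[R]_n) :
  S p -> (forall s, S s -> dotp (v - p) s = 0) -> orth_proj S v = p.
Proof.
move=> Sp vp; rewrite /orth_proj; case: xgetP => [q _ [Sq vq]|/(_ p)[]//].
apply/eqP; rewrite -subr_eq0 -dotp_eq0.
have dE s : dotp (q - p) s = dotp (v - p) s - dotp (v - q) s.
  by rewrite -dotpBl opprB [v - p + _]addrC subrKA.
by rewrite dotpBr !dE !(vp, vq) // !subrr.
Qed.

End DotProduct.

(** * The pseudoinverse *)

Section Pseudoinverse.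
Context {R : realType}.

(** If A^T A K = 0 then A K = 0 by [gram_eq0], and a left inverse of A cancels
A. *)
Lemma gram_unit m n (A : 'M[R]_(m, n)) : row_full A -> A^T *m A \in unitmx.
Proof.
case/row_fullP => L LA; rewrite -unitmx_tr -row_free_unit -kermx_eq0.
set K := kermx _.
have /(congr1 trmx) : K *m (A^T *m A)^T = 0 by exact: mulmx_ker.
rewrite trmx_mul trmxK trmx0 => /gram_eq0 /(congr1 (mulmx L)).
by rewrite mulmxA LA mul1mx mulmx0 => /(congr1 trmx); rewrite trmxK trmx0 => ->.
Qed.

(** In a full-rank factorisation A = C B both Gram matrices C^T C and B B^T are
invertible.  For P = B^T (B B^T)^-1 (C^T C)^-1 C^T they cancel in A P and P A,
leaving the symmetric projections C (C^T C)^-1 C^T and B^T (B B^T)^-1 B. *)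
Lemma moore_penrose_exists m n (A : 'M[R]_(m, n)) :
  exists P, moore_penrose A P.
Proof.
have := mulmx_base A; move: (col_base_full A) (row_base_free A).
move: (col_base A) (row_base A) => C B fullC freeB <-.
have uC := gram_unit fullC.
have uB : B *m B^T \in unitmx.
  rewrite -[X in X *m _]trmxK; apply: gram_unit.
  by rewrite /row_full mxrank_tr; exact: freeB.
set GC := C^T *m C in uC; set GB := B *m B^T in uB.
have CP : C *m B *m (B^T *m invmx GB *m (invmx GC *m C^T)) =
          C *m invmx GC *m C^T.
  by rewrite !mulmxA -[C *m B *m B^T]mulmxA mulmxK.
have PC : B^T *m invmx GB *m (invmx GC *m C^T) *m (C *m B) =
          B^T *m invmx GB *m B.
  by rewrite !mulmxA -[_ *m C^T *m C]mulmxA mulmxKV.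
exists (B^T *m invmx GB *m (invmx GC *m C^T)); split.
- by rewrite CP !mulmxA -[_ *m C^T *m C]mulmxA mulmxKV.
- by rewrite PC !mulmxA -[_ *m B *m B^T]mulmxA mulmxKV.
- by rewrite CP !trmx_mul trmxK trmx_inv [GC^T]trmx_mul trmxK mulmxA.
- by rewrite PC !trmx_mul trmxK trmx_inv [GB^T]trmx_mul trmxK mulmxA.
Qed.

Lemma pinvmpP m n (A : 'M[R]_(m, n)) : moore_penrose A (pinvmp A).
Proof.
have [P AP] := moore_penrose_exists A.
by rewrite /pinvmp; case: xgetP => [Q _ //|/(_ P)].
Qed.

(** The normal equations: A^T A P = A^T (A P)^T = (A P A)^T = A^T for
P = A^+. *)
Lemma pinvmp_normal_eq m n (A : 'M[R]_(m, n)) (b : 'cV[R]_m) :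
  A^T *m (A *m (pinvmp A *m b) - b) = 0.
Proof.
have [APA _ symAP _] := pinvmpP A.
by rewrite mulmxBr 2!mulmxA -mulmxA -symAP mulmxA -trmx_mul APA subrr.
Qed.

(** P = P A P = (P A)^T P = A^T P^T P for P = A^+. *)
Lemma pinvmp_range m n (A : 'M[R]_(m, n)) (b : 'cV[R]_m) :
  range_mx A^T (pinvmp A *m b).
Proof.
have [_ PAP _ symPA] := pinvmpP A.
exists ((pinvmp A)^T *m (pinvmp A *m b)) => //.
by rewrite mulmxA -trmx_mul symPA mulmxA PAP.
Qed.

End Pseudoinverse.

(** * Least squares *)

Section LeastSquares.
Context {R : realType} {m n : nat}.
Variables (A : 'M[R]_(m, n)) (b : 'cV[R]_m).
Let xLS := pinvmp A *m b.

(** A z - b = A (z - xLS) + (A xLS - b), and the normal equations make the two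
terms orthogonal. *)
Lemma residual_pythagoras (z : 'cV[R]_n) :
  dotp (A *m z - b) (A *m z - b) =
  dotp (A *m (z - xLS)) (A *m (z - xLS)) +
  dotp (A *m xLS - b) (A *m xLS - b).
Proof.
rewrite -pythagoras.
  by rewrite mulmxBr addrA subrK.
by rewrite dotp_mulmx pinvmp_normal_eq dotpE mulmx0 mxE.
Qed.

Lemma residual_min (z : 'cV[R]_n) : enorm (A *m xLS - b) <= enorm (A *m z - b).
Proof. by rewrite enorm_le (residual_pythagoras z) lerDr dotp_ge0. Qed.

Lemma residual_argmin (z : 'cV[R]_n) :
  enorm (A *m z - b) <= enorm (A *m xLS - b) -> A *m (z - xLS) = 0.
Proof.
rewrite enorm_le (residual_pythagoras z) gerDr => le0.
by apply/eqP; rewrite -dotp_eq0 eq_le le0 dotp_ge0.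
Qed.

Lemma dotp_range_null (r y : 'cV[R]_n) :
  range_mx A^T r -> A *m y = 0 -> dotp y r = 0.
Proof.
by case=> w _ <- Ay; rewrite dotpC dotp_mulmx trmxK Ay dotpE mulmx0 mxE.
Qed.

(** The minimisers of the residual differ only by null vectors, which the
projection onto range(A^T) kills. *)
Lemma orth_proj_range_pinvmp (z : 'cV[R]_n) :
  A *m (z - xLS) = 0 -> orth_proj (range_mx A^T) z = xLS.
Proof.
move=> Az; apply: orth_proj_unique; first exact: pinvmp_range.
by move=> s As; apply: dotp_range_null.
Qed.

(** Any other minimiser z is the orthogonal sum of z - xLS in null(A) and xLS in
range(A^T), so it is strictly longer. *)
Lemma pinvmp_min_norm_lsq : min_norm_least_squares_sol A b xLS.
Proof.
split=> [z|z zLS zx]; first exact: residual_min.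
have Az := residual_argmin (zLS xLS).
rewrite enorm_lt -[z](subrK xLS) pythagoras; last first.
  by apply: dotp_range_null Az; apply: pinvmp_range.
by rewrite ltrDr lt_def dotp_ge0 dotp_eq0 subr_eq0 zx.
Qed.

End LeastSquares.

(** * Existence of the smallest nonzero singular value *)

Section SingularValues.
Context {R : realType}.

(** Seen over the complex numbers, M is hermitian, hence M = P^-1 D P with D
diagonal and real; d is the diagonal of D.  The matrix P is complex, but an
eigenvalue of M over the complex numbers that happens to be real is an
eigenvalue over the reals, because the rank of M - a does not change. *)
Lemma symmetric_spectrum n (M : 'M[R]_n) : M^T = M ->
  exists d : 'rV[R]_n,
    (forall a, eigenvalue M a <-> exists i, d 0 i = a) /\ (d = 0 -> M = 0).
Proof.
move=> symM.
pose f := real_complex R; pose MC : 'M[R[i]]_n := map_mx f M.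
have hermM : MC \is hermsymmx.
  apply: realsym_hermsym.
    by apply/is_hermitianmxP; rewrite expr0 scale1r map_mx_id // map_trmx symM.
  by apply/mxOverP => i j; rewrite mxE; apply/complex_realP; exists (M i j).
have /orthomx_spectralP := hermitian_normalmx hermM.
have := hermitian_spectral_diag_real hermM.
have := spectral_unit MC.
move: (spectralmx MC) (spectral_diag MC) => P sp uP sp_real MCE.
exists (map_mx (@complex.Re R) sp).
have spE : sp = map_mx f (map_mx (@complex.Re R) sp).
  by apply/matrixP => i j; rewrite !mxE [f _]RRe_real //; apply: (mxOverP sp_real).
move: (map_mx _ sp) spE => d spE; rewrite {sp sp_real}spE in MCE.
split=> [a|d0]; last first.
  apply: (map_mx_inj (f := f)).
  by rewrite map_mx0 -/MC MCE d0 map_mx0 raddf0 mulmx0 mul0mx.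
rewrite -(eigenvalue_map f) -/MC; split.
  case/eigenvalueP => v vM v0.
  (* Coordinates of the eigenvector in the diagonalising basis. *)
  pose w := v *m invmx P.
  have w0 : w != 0.
    apply: contraNneq v0 => w0.
    by rewrite -[v](mulmxKV uP) -/w w0 mul0mx.
  have wD : w *m diag_mx (map_mx f d) = f a *: w.
    by rewrite /w scalemxAl -vM MCE !mulmxA mulmxK.
  clearbody w; have /rV0Pn[i wi] := w0.
  exists i; apply: (fmorph_inj f).
  have /matrixP/(_ 0 i) := wD.
  by rewrite mul_mx_diag !mxE mulrC => /(mulIf wi).
case=> i <-; apply/eigenvalueP; exists (delta_mx 0 i *m P).
  rewrite MCE !mulmxA mulmxK // scalemxAl; congr (_ *m _).
  by rewrite -rowE row_diag_mx !mxE.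
apply/eqP => /(congr1 (mulmx^~ (invmx P))); rewrite mulmxK // mul0mx.
by move=> /matrixP/(_ 0 i)/eqP; rewrite !mxE !eqxx oner_eq0.
Qed.

(** If v A^T A = a v then a |v|^2 = |A v^T|^2. *)
Lemma gram_eigenvalue_ge0 m n (A : 'M[R]_(m, n)) a :
  eigenvalue (A^T *m A) a -> 0 <= a.
Proof.
case/eigenvalueP => v vM v0.
have vT0 : 0 < dotp v^T v^T.
  by rewrite lt_def dotp_ge0 dotp_eq0 trmx_eq0 v0.
rewrite -(pmulr_lge0 _ vT0).
suff -> : a * dotp v^T v^T = dotp (A *m v^T) (A *m v^T) by exact: dotp_ge0.
by rewrite dotp_mulmx !dotpE trmxK !mulmxA -[v *m A^T *m A]mulmxA vM
  -scalemxAl !mxE.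
Qed.

(** The singular values are the square roots of the eigenvalues of A^T A, so the
smallest nonzero one is the root of the smallest nonzero entry of the finite
spectrum d. *)
Lemma sigma_min_gt0 m n (A : 'M[R]_(m, n)) : A != 0 -> 0 < sigma_min A.
Proof.
move=> A0; have symM : (A^T *m A)^T = A^T *m A by rewrite trmx_mul trmxK.
have [d [dP d0]] := symmetric_spectrum symM.
have [i di] : exists i, d 0 i != 0.
  apply/rV0Pn; apply: contraNneq A0 => /d0 M0; rewrite -[A]mulmx1.
  by apply/eqP/gram_eq0; rewrite M0 mul0mx.
have dge0 j : 0 <= d 0 j by apply/gram_eigenvalue_ge0/dP; exists j.
pose k := [arg min_(j < i | d 0 j != 0) d 0 j]%O.
rewrite /sigma_min; case: xgetP => [s _ [[s0 _] sn0 _]|/(_ (Num.sqrt (d 0 k)))[]].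
  by rewrite lt_def sn0.
rewrite /k; case: arg_minP => // {}k dk kmin; split.
- by split; rewrite ?sqrtr_ge0 // sqr_sqrtr //; apply/dP; exists k.
- by rewrite sqrtr_eq0 -ltNge lt_def dk dge0.
- move=> t [t0 /dP[j dj]] tn0.
  rewrite -[t]ger0_norm // -sqrtr_sqr ler_sqrt ?sqr_ge0 // -dj kmin // dj.
  by rewrite expf_neq0.
Qed.

End SingularValues.

(** * The smallest ball *)

Unset Implicit Arguments.

Theorem corollary4 (R : realType) (m n : nat) (A : 'M[R]_(m, n))
    (b : 'cV[R]_m) (x0 : 'cV[R]_n) (hA : A != 0) :
  let xLS := pinvmp A *m b in
  [/\ min_norm_least_squares_sol A b xLS,
      forall y : 'cV[R]_n, null_mx A y ->
        smallest_ball (error_balls A b x0) (error_ball A b x0 (xLS + y))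
    & forall B : eball R n, smallest_ball (error_balls A b x0) B ->
        center B = orth_proj (null_mx A) x0 + xLS].
Proof.
move=> xLS; have s_gt0 := sigma_min_gt0 hA; split.
- exact: pinvmp_min_norm_lsq.
- move=> y Ay; split=> [|_ [z _ <-]]; first by exists (xLS + y).
  by rewrite /= mulmxDr Ay addr0 ler_pM2r ?invr_gt0 // residual_min.
- move=> _ [[z _ <-] zmin].
  have /zmin : error_balls A b x0 (error_ball A b x0 xLS) by exists xLS.
  rewrite /= ler_pM2r ?invr_gt0 // => /residual_argmin Az.
  by rewrite (orth_proj_range_pinvmp Az).
Qed.
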